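(* Let $m\ge 5$ be an odd integer. Then each of the quaternary cyclic codes $\mathcal{C}_{(0,m)}$ and $\mathcal{C}_{(1,m)}$ has parameters $[4^m-1,\,2^{2m-1},\,d]$ (length, dimension over $\mathbb{F}_4$, minimum Hamming distance), where $$d\ \ge\ \begin{cases}4^{\frac{m-1}{2}}+1 & \text{if } m\equiv 1 \pmod 4,\\[2pt] 4^{\frac{m-3}{2}}+1 & \text{if } m\equiv 3\pmod 4.\end{cases}$$
   Context: Let $m\ge 1$ be an integer and $n=4^m-1$. For an integer $0\le i\le 4^m-1$ with base-$4$ expansion $i=\sum_{j=0}^{m-1} i_j4^j$, $i_j\in\{0,1,2,3\}$, the $4$-weight is $w_4(i)=\sum_{j=0}^{m-1} i_j$ (sum in $\mathbb{Z}$). For $e\in\{0,1\}$ put $T_{(e,m)}=\{1\le i\le n-1 : w_4(i)\equiv e \pmod 2\}$. Fix a generator $\alpha$ of $\mathbb{F}_{4^m}^*$. The code $\mathcal{C}_{(e,m)}$ is the cyclic code of length $n$ over $\mathbb{F}_4$ (ideal of $\mathbb{F}_4[x]/(x^n-1)$) with generator polynomial $g_{(e,m)}(x)=\prod_{j\in T_{(e,m)}}(x-\alpha^j)\in\mathbb{F}_4[x]$. *)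

(* Defs.v *)
From HB Require Import structures.
From mathcomp Require Import all_boot all_order all_fingroup all_algebra.
From mathcomp Require Import all_solvable all_field zify.

Set Implicit Arguments.
Unset Strict Implicit.
Unset Printing Implicit Defensive.

Import GRing.Theory.
Local Open Scope ring_scope.

Definition hamming_dist (F : eqType) (n : nat) (u v : 'rV[F]_n) : nat :=
  #|[set i | u ord0 i != v ord0 i]|.

Definition is_min_distance (F : fieldType) (n : nat) (C : {vspace 'rV[F]_n})
    (d : nat) : Prop :=
  (exists u v, [/\ u \in C, v \in C, u != v & hamming_dist u v = d]) /\
  (forall u v, u \in C -> v \in C -> u != v -> (d <= hamming_dist u v)%N).

(* The length of an [n, k, d] code is the n in the type of C. *)
Definition has_parameters (F : fieldType) (n : nat) (C : {vspace 'rV[F]_n})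
    (k d : nat) : Prop :=
  \dim C = k /\ is_min_distance C d.

(* For n > 0 the modulus is monic of size n.+1 > 1, so that                 *)
(* {poly %/ 'X^n - 1} really is F[x]/(x^n - 1), see mk_monic.               *)
Definition cyclic_ideal (F : fieldType) (n : nat) (g : {poly F}) :
    {vspace {poly %/ ('X^n - 1 : {poly F})}} :=
  limg (linfun (in_qpoly ('X^n - 1) g \*o idfun)).

(* c_0 + c_1 x + ... + c_(n-1) x^(n-1) is read as (c_0, ..., c_(n-1)).      *)
Definition coef_vector (F : fieldType) (n : nat)
    (c : {poly %/ ('X^n - 1 : {poly F})}) : 'rV[F]_n :=
  poly_rV (polyn c).

Definition cyclic_code (F : fieldType) (n : nat) (g : {poly F}) :
    {vspace 'rV[F]_n} :=
  (linfun (@coef_vector F n) @: cyclic_ideal n g)%VS.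

Lemma mem_cyclic_ideal (F : fieldType) (n : nat) (g : {poly F})
    (c : {poly %/ ('X^n - 1 : {poly F})}) :
  c \in cyclic_ideal n g <-> exists a, c = in_qpoly ('X^n - 1) g * a.
Proof.
split=> [/memv_imgP[a _ ->]|[a ->]]; first by exists a; rewrite lfunE.
by apply/memv_imgP; exists a; rewrite ?memvf // lfunE.
Qed.

Fact coef_vector_is_linear (F : fieldType) (n : nat) :
  linear (@coef_vector F n).
Proof. by move=> a p q; rewrite /coef_vector !linearP. Qed.

HB.instance Definition _ (F : fieldType) (n : nat) :=
  GRing.isSemilinear.Build F {poly %/ ('X^n - 1 : {poly F})} 'rV[F]_n _
    (@coef_vector F n) (GRing.semilinear_linear (@coef_vector_is_linear F n)).

Lemma mem_cyclic_code (F : fieldType) (n : nat) (g : {poly F}) v :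
  v \in cyclic_code n g <->
  exists2 c, c \in cyclic_ideal n g & v = coef_vector c.
Proof.
split=> [/memv_imgP[c Cc ->]|[c Cc ->]]; first by exists c; rewrite ?lfunE.
by apply/memv_imgP; exists c; rewrite ?lfunE.
Qed.

Definition weight4 (m i : nat) : nat := (\sum_(j < m) (i %/ 4 ^ j) %% 4)%N.

Definition defining_set (m e : nat) : {set 'I_(4 ^ m - 1)} :=
  [set i : 'I__ | (0 < i)%N && (weight4 m i == e %[mod 2])].

Lemma weight4_top k t r : (r < 4 ^ k)%N -> (t < 4)%N ->
  weight4 k.+1 (t * 4 ^ k + r) = (weight4 k r + t)%N.
Proof.
move=> lt_r lt_t; rewrite /weight4 big_ord_recr /= divnMDl ?expn_gt0 //.
rewrite (divn_small lt_r) addn0 (modn_small lt_t); congr (_ + _)%N.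
apply: eq_bigr => j _; have -> : (4 ^ k = 4 ^ (k - j.+1) * 4 * 4 ^ j)%N.
  by rewrite -mulnA -expnS -expnD subnK.
by rewrite mulnA divnMDl ?expn_gt0 // mulnA modnMDl.
Qed.

Lemma weight4_bot k t r : (t < 4)%N ->
  weight4 k.+1 (4 * r + t) = (t + weight4 k r)%N.
Proof.
move=> lt_t; rewrite /weight4 big_ord_recl /= expn0 divn1 mulnC modnMDl.
rewrite (modn_small lt_t); congr (_ + _)%N; apply: eq_bigr => j _.
by rewrite /= /bump /= add1n expnS divnMA divnMDl // (divn_small lt_t) addn0.
Qed.

Lemma weight4_rot m (i : nat) : (i < 4 ^ m - 1)%N ->
  weight4 m ((4 * i) %% (4 ^ m - 1)) = weight4 m i.
Proof.
case: m => [|k] //= lt_i; set n := (4 ^ k.+1 - 1)%N in lt_i *.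
have k0 : (0 < 4 ^ k)%N by rewrite expn_gt0.
pose t := (i %/ 4 ^ k)%N; pose r := (i %% 4 ^ k)%N.
have lt_t : (t < 4)%N.
  by rewrite /t ltn_divLR // -expnS (leq_trans lt_i) // leq_subr.
have lt_r : (r < 4 ^ k)%N by rewrite ltn_pmod.
have Ei : i = (t * 4 ^ k + r)%N by rewrite -divn_eq.
have [E4i lt_rt] : (4 * i = t * n + (4 * r + t) /\ 4 * r + t < n)%N.
  move: lt_i lt_t lt_r Ei; rewrite /n expnS; move: (4 ^ k)%N t r => b t r.
  by case: t => [|[|[|[|t]]]] //=; lia.
by rewrite E4i modnMDl modn_small // weight4_bot // [in RHS]Ei weight4_top // addnC.
Qed.

Section GeneratorPolynomial.

Variables (F K : finFieldType) (iota : {rmorphism F -> K}).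
Variables (alpha : {unit K}) (m e : nat).

(* F plays F_4, K plays F_(4^m), and iota is the inclusion.                 *)
Definition gen_poly_ext : {poly K} :=
  \prod_(j in defining_set m e) ('X - (val alpha ^+ j)%:P).

Definition iota_inv (y : K) : F := odflt 0 [pick c | iota c == y].

(* The polynomial over F that maps to gen_poly_ext (see map_gen_poly).      *)
Definition gen_poly : {poly F} := map_poly iota_inv gen_poly_ext.

Definition code : {vspace 'rV[F]_(4 ^ m - 1)} :=
  cyclic_code (4 ^ m - 1) gen_poly.

End GeneratorPolynomial.

Lemma map_iota_inv (F K : finFieldType) (iota : {rmorphism F -> K})
    (p : {poly K}) :
  (forall i, p`_i ^+ #|F| = p`_i) ->
  map_poly iota (map_poly (iota_inv iota) p) = p.
Proof.
move=> pF.
have iota_invK y : y ^+ #|F| = y -> iota (iota_inv iota y) = y.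
  move=> yF; rewrite /iota_inv; case: pickP => [c /eqP //|no_c].
  have := congr1 (fun q => (map_poly iota q).[y]) (finField_genPoly F).
  rewrite rmorphB /= map_polyXn map_polyX !hornerE yF subrr rmorph_prod /=.
  rewrite horner_prod => /esym/eqP/prodf_eq0[c _].
  by rewrite map_polyXsubC hornerXsubC subr_eq0 eq_sym no_c.
have inv0 : iota_inv iota 0 = 0.
  by apply: (fmorph_inj iota); rewrite iota_invK ?rmorph0 // expr0n; case: #|F| (finNzRing_gt1 F).
apply/polyP=> i; rewrite coef_map coef_map_id0 //=; exact: iota_invK.
Qed.

Lemma map_gen_poly (F K : finFieldType) (iota : {rmorphism F -> K})
    (alpha : {unit K}) (m e : nat) :
  #|F| = 4 -> #|K| = (4 ^ m)%N ->
  map_poly iota (gen_poly iota alpha m e) = gen_poly_ext alpha m e.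
Proof.
move=> cF cK; apply: map_iota_inv => i; rewrite cF.
set n := (4 ^ m - 1)%N.
have alphan : val alpha ^+ n = 1.
  have a0 : val alpha != 0 by rewrite -unitfE (valP alpha).
  apply: (mulfI a0); rewrite mulr1 -exprS /n subn1 prednK ?expn_gt0 //.
  by rewrite -cK expf_card.
have pchK : 2 \in [pchar K].
  by apply: (@card_finPcharP K 2 (2 * m)); rewrite // cK expnM.
pose phi : {rmorphism K -> K} := pFrobenius_aut pchK \o pFrobenius_aut pchK.
have phiE x : phi x = x ^+ 4 by rewrite /= !pFrobenius_autE -exprM.
have n0 : 'I_n -> (0 < n)%N by case=> j /= /(leq_ltn_trans (leq0n j)).
pose rot (j : 'I_n) := Ordinal (ltn_pmod (4 * j) (n0 j)).
have co4 : coprime n 4.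
  rewrite coprime_sym (@coprimeXl 2 2 n) // coprime2n.
  by have := finNzRing_gt1 K; rewrite /n cK; case: (m) => [|k] // _; rewrite expnS; lia.
have rot_inj : injective rot.
  move=> j1 j2 /(congr1 val) /= /eqP; wlog le12 : j1 j2 / (j2 <= j1)%N => [wl|].
    by case/orP: (leq_total j1 j2) => le; [rewrite eq_sym => /wl->|apply: wl].
  rewrite eqn_mod_dvd ?leq_mul2l // -mulnBr Gauss_dvdr // -eqn_mod_dvd //.
  by rewrite !modn_small // => /eqP/val_inj.
have rot_in j : (rot j \in defining_set m e) = (j \in defining_set m e).
  rewrite !inE /= weight4_rot //; congr (_ && _).
  rewrite !lt0n -/(dvdn n (4 * j)) Gauss_dvdr // /dvdn modn_small //.
have phiG : map_poly phi (gen_poly_ext alpha m e) = gen_poly_ext alpha m e.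
  rewrite /gen_poly_ext rmorph_prod [RHS](reindex_inj rot_inj) /=.
  apply: eq_big => [j|j _]; first by rewrite rot_in.
  rewrite map_polyXsubC phiE -exprM mulnC; congr ('X - _%:P).
  by rewrite {1}(divn_eq (4 * j) n) exprD mulnC exprM alphan expr1n mul1r.
by rewrite -phiE -[in RHS]phiG coef_map.
Qed.

(* Main.v *)
(* Put m = 2h + 1, n = 4^m - 1 and w = 4^h + 1.  For 0 < a <= 4^h the         *)
(* base-4 digits of a occur twice in aw, so the 4-weight of aw is even; since  *)
(* w is coprime to n, the BCH bound with b = alpha^w gives d >= 4^h + 1 for    *)
(* e = 0.  As the 4-weights of i and n - i add up to the odd number 3m,        *)
(* i |-> n - i exchanges the defining sets for e = 0 and e = 1: this gives     *)
(* the same bound for e = 1 with b = alpha^-w, and the dimension, because      *)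
(* each defining set is half of {1, ..., n - 1}.                               *)
Require Import Defs.
From HB Require Import structures.
From mathcomp Require Import all_boot all_order all_fingroup all_algebra.
From mathcomp Require Import all_solvable all_field zify.

Set Implicit Arguments.
Unset Strict Implicit.
Unset Printing Implicit Defensive.

Import GRing.Theory.
Local Open Scope ring_scope.

(** When g divides X^n - 1, the code consists of the multiples of g of degree below n, so its
    dimension is n - deg g and every word vanishes at the roots of g. Doubling of base-4 digits
    ([weight4_even_multiple]) puts w, 2w, ..., 4^h w into the even defining set, and [weight4_compl]
    puts their negatives into the odd one. Powers of alpha^w, respectively alpha^-w, then give 4^h
    consecutive roots; these powers are distinct by [coprime_multiplier], so [bch_bound] yields d >=
    4^h + 1. The same complement i -> n - i gives deg g ([card_defining_set]). As h = (m-1)/2, this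
    is the claimed bound for m = 1 mod 4 and exceeds it for m = 3 mod 4. *)

(** * Cyclic codes as multiples of the generator *)

Lemma mk_monic_XnsubC1 (R : nzRingType) (n : nat) :
  (0 < n)%N -> mk_monic ('X^n - 1 : {poly R}) = 'X^n - 1.
Proof.
by move=> n0; rewrite /mk_monic -polyC1 size_XnsubC // monicXnsubC // ltnS n0.
Qed.

(** Since g divides X^n - 1, reduction modulo X^n - 1 preserves divisibility by g. *)
Lemma mem_cyclic_code_dvdp (F : fieldType) (n : nat) (g : {poly F}) v :
  (0 < n)%N -> g %| 'X^n - 1 -> (v \in cyclic_code n g) = (g %| rVpoly v).
Proof.
move=> n0 gdvd; pose h : {poly F} := 'X^n - 1.
have hE : mk_monic h = h by exact: mk_monic_XnsubC1.
have h_mon : h \is monic by rewrite -hE monic_mk_monic.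
have szh : size h = n.+1 by rewrite /h -polyC1 size_XnsubC.
have qE p : polyn (in_qpoly h p) = p %% h.
  by rewrite /= hE -Pdiv.IdomainMonic.modpE.
have qM (p q : {poly %/ h}) : polyn (p * q) = (polyn p * polyn q) %% h.
  by rewrite -qE.
have h0 : h != 0 by exact: monic_neq0.
apply/idP/idP => [/mem_cyclic_code [c] /mem_cyclic_ideal [a ->] ->|].
  rewrite /coef_vector qM qE poly_rV_K; last by rewrite -ltnS -szh ltn_modp.
  by rewrite -dvdp_mod // dvdp_mulr // -dvdp_mod.
move=> /dvdpP [q vE]; apply/mem_cyclic_code.
have small : rVpoly v %% h = rVpoly v.
  by rewrite modp_small // szh ltnS size_poly.
exists (in_qpoly h (rVpoly v)); last by rewrite /coef_vector qE small rVpolyK.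
apply/mem_cyclic_ideal; exists (in_qpoly h q); apply: val_inj.
by rewrite [LHS]qE [RHS]qM !qE modp_mul [in RHS]mulrC modp_mul vE.
Qed.

(** Multiplication by g maps the polynomials of degree below n - deg g injectively onto the code. *)
Lemma dim_cyclic_code (F : fieldType) (n : nat) (g : {poly F}) :
  (0 < n)%N -> g %| 'X^n - 1 -> \dim (cyclic_code n g) = (n - (size g).-1)%N.
Proof.
move=> n0 gdvd; set k := (n - _)%N.
have szh : size ('X^n - 1 : {poly F}) = n.+1 by rewrite -polyC1 size_XnsubC.
have h0 : 'X^n - 1 != 0 :> {poly F} by rewrite -size_poly_eq0 szh.
have g0 : g != 0 by apply: contraTneq gdvd => ->; rewrite dvd0p.
have szg : (size g <= n.+1)%N by rewrite -szh dvdp_leq.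
have sg0 : (0 < size g)%N by rewrite size_poly_gt0.
(* With [arith']: for nonzero u, the product g u has size at most n exactly when u has size at most
   k. *)
have arith x : (0 < x)%N -> (x <= k)%N -> ((size g + x).-1 <= n)%N.
  by rewrite /k; move: (size g) sg0 szg => y; lia.
have arith' x : (0 < x)%N -> ((x + size g).-1 <= n)%N -> (x <= k)%N.
  by rewrite /k; move: (size g) sg0 szg => y; lia.
pose f (u : 'rV[F]_k) : 'rV[F]_n := poly_rV (g * rVpoly u).
have f_lin : linear f.
  by move=> a u w; rewrite /f linearP mulrDr -scalerAr linearP.
pose fL := GRing.isLinear.Build _ _ _ _ f f_lin.
pose fl : {linear 'rV[F]_k -> 'rV[F]_n} := HB.pack f fL.
have szf (u : 'rV[F]_k) : (size (g * rVpoly u)%R <= n)%N.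
  have [->|u0] := eqVneq (rVpoly u) 0; first by rewrite mulr0 size_poly0.
  have /= szu : (size (rVpoly u) <= k)%N by exact: size_poly.
  rewrite -size_poly_gt0 in u0; rewrite size_mul // -?size_poly_gt0 //.
  exact: arith u0 szu.
have -> : cyclic_code n g = limg (linfun fl).
  apply/vspaceP => v; rewrite mem_cyclic_code_dvdp //.
  apply/idP/memv_imgP => [/dvdpP [q vE]|[u _ ->]].
    exists (poly_rV q); rewrite ?memvf // lfunE /= /f poly_rV_K; last first.
      have [->|q0] := eqVneq q 0; first by rewrite size_poly0.
      have : (size (rVpoly v) <= n)%N by exact: size_poly.
      by rewrite vE size_mul //; apply: arith'; rewrite size_poly_gt0.
    by rewrite mulrC -vE rVpolyK.
  by rewrite lfunE /= /f poly_rV_K // dvdp_mulr.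
rewrite limg_dim_eq ?dimvf /dim /= ?mul1n //.
apply/eqP; rewrite -subv0; apply/subvP => u.
rewrite memv_cap memv_ker => /andP [_ /eqP fu0].
have /(congr1 rVpoly) : f u = 0 := etrans (esym (lfunE fl u)) fu0.
rewrite /f poly_rV_K // linear0 => /eqP.
rewrite mulf_eq0 (negPf g0) /= => /eqP /(congr1 (@poly_rV F k)).
by rewrite rVpolyK linear0 => ->; rewrite mem0v.
Qed.

(** * Minimum distance and the BCH bound *)

Lemma hamming_dist_sub (F : fieldType) (n : nat) (u v : 'rV[F]_n) :
  hamming_dist (u - v) 0 = hamming_dist u v.
Proof.
rewrite /hamming_dist; congr #|pred_of_set _|; apply/setP=> i.
by rewrite !inE !mxE subr_eq0.
Qed.

(** By linearity the minimum distance is the least weight of a nonzero word; finiteness of F makes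
    that search decidable. *)
Lemma exists_min_distance (F : finFieldType) (n : nat) (C : {vspace 'rV[F]_n})
    (s : nat) :
  C != 0%VS -> (forall v, v \in C -> v != 0 -> (s <= hamming_dist v 0)%N) ->
  exists2 d, is_min_distance C d & (s <= d)%N.
Proof.
move=> C0 C_s.
pose P d := [exists v : 'rV[F]_n, [&& v \in C, v != 0 & hamming_dist v 0 == d]].
have exP : exists d, P d.
  exists (hamming_dist (vpick C) 0); apply/existsP; exists (vpick C).
  by rewrite memv_pick vpick0 C0 eqxx.
case: (ex_minnP exP) => d /existsP [v /and3P [Cv v0 /eqP vd]] d_min.
exists d; last by rewrite -vd C_s.
split=> [|u w Cu Cw neq_uw]; first by exists v, 0; rewrite mem0v.
rewrite -hamming_dist_sub; apply: d_min; apply/existsP; exists (u - w).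
by rewrite rpredB // subr_eq0 neq_uw /=.
Qed.

(** A word of weight at most s would be orthogonal to a test polynomial that isolates one coordinate
    of its support. The extra factor b^j in [v_orth] appears because the roots start at exponent
    1. *)
Lemma bch_bound (F K : fieldType) (iota : {rmorphism F -> K}) (n s : nat)
    (b : K) (v : 'rV[F]_n) :
  b != 0 -> injective (fun j : 'I_n => b ^+ j) -> v != 0 ->
  (forall a, (0 < a <= s)%N -> root (map_poly iota (rVpoly v)) (b ^+ a)) ->
  (s < hamming_dist v 0)%N.
Proof.
move=> b0 b_inj v0 v_root; rewrite ltnNge; apply/negP => le_s.
have v_eval x :
    (map_poly iota (rVpoly v)).[x] = \sum_(j < n) iota (v 0 j) * x ^+ j.
  rewrite (@horner_coef_wide _ n) ?size_map_poly ?size_poly //.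
  by apply: eq_bigr => j _; rewrite coef_map /= coef_rVpoly_ord.
(* Testing v against any f of degree below s; this replaces the usual        *)
(* Vandermonde determinant.                                                  *)
have v_orth (f : {poly K}) : (size f <= s)%N ->
    \sum_(j < n) iota (v 0 j) * b ^+ j * f.[b ^+ j] = 0.
  move=> szf; transitivity
    (\sum_(j < n) \sum_(a < s) f`_a * (iota (v 0 j) * (b ^+ a.+1) ^+ j)).
    apply: eq_bigr => j _; rewrite (horner_coef_wide _ szf) mulr_sumr.
    apply: eq_bigr => a _.
    by rewrite mulrCA -mulrA -!exprM mulSn exprD [(j * a)%N]mulnC.
  rewrite exchange_big big1 // => a _; rewrite -mulr_sumr -v_eval.
  by rewrite (rootP (v_root a.+1 (ltn_ord a))) mulr0.
have [j0 vj0] : exists j, v 0 j != 0 by apply/rV0Pn.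
pose D := [set i | v 0 i != 0].
have D_s : (#|D| <= s)%N.
  apply: leq_trans le_s; apply: subset_leq_card; apply/subsetP => i.
  by rewrite !inE mxE.
(* This f vanishes at every support point except b^j0, so only the nonzero term at j0 survives in
   [v_orth]. *)
pose f := \prod_(j in D :\ j0) ('X - (b ^+ j)%:P).
have szf : (size f <= s)%N.
  apply: leq_trans D_s; rewrite /f -big_enum size_prod_XsubC -cardE.
  by rewrite (cardsD1 j0 D) inE vj0.
have /eqP := v_orth _ szf; rewrite (bigD1 j0) //= big1 ?addr0 => [|j nj].
  rewrite mulf_eq0 mulf_eq0 fmorph_eq0 (negPf vj0) expf_eq0 (negPf b0) andbF /=.
  rewrite horner_prod => /prodf_eq0 [j]; rewrite !inE => /andP [nj _].
  by rewrite hornerXsubC subr_eq0 => /eqP /b_inj jE; rewrite jE eqxx in nj.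
have [->|vj] := eqVneq (v 0 j) 0; first by rewrite rmorph0 !mul0r.
apply/eqP; rewrite mulf_eq0; apply/orP; right; rewrite horner_prod.
by apply/prodf_eq0; exists j; rewrite ?inE ?nj // hornerXsubC subrr.
Qed.

(** * Base-4 digits and the size of the defining sets *)

Lemma weight4_cat (k l a b : nat) : (a < 4 ^ k)%N ->
  weight4 (k + l) (4 ^ k * b + a) = (weight4 k a + weight4 l b)%N.
Proof.
move=> lt_a; rewrite /weight4 big_split_ord /=; congr (_ + _)%N.
  apply: eq_bigr => j _; have -> : (4 ^ k = 4 ^ j * 4 ^ (k - j))%N.
    by rewrite -expnD subnKC // ltnW.
  rewrite -mulnA [(4 ^ j * _)%N]mulnC divnMDl ?expn_gt0 //.
  have : (0 < k - j)%N by rewrite subn_gt0.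
  by case: (k - j)%N => // t _; rewrite expnS -mulnA -modnDml modnMr.
apply: eq_bigr => j _.
by rewrite expnD divnMA mulnC divnMDl ?expn_gt0 // (divn_small lt_a) addn0.
Qed.

(** All digits of 4^k - 1 are 3, so the subtraction has no borrow and turns each digit t into 3 -
    t. *)
Lemma weight4_compl (k i : nat) : (i < 4 ^ k)%N ->
  (weight4 k (4 ^ k - 1 - i) + weight4 k i = 3 * k)%N.
Proof.
elim: k i => [|k IHk] i lt_i; first by rewrite /weight4 !big_ord0.
have lt_r : (i %/ 4 < 4 ^ k)%N by rewrite ltn_divLR // mulnC -expnS.
have lt_t : (i %% 4 < 4)%N by rewrite ltn_pmod.
have iE : i = (4 * (i %/ 4) + i %% 4)%N by rewrite mulnC -divn_eq.
have cE : (4 ^ k.+1 - 1 - i = 4 * (4 ^ k - 1 - i %/ 4) + (3 - i %% 4))%N.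
  rewrite expnS in lt_i *; move: (4 ^ k)%N (i %/ 4)%N (i %% 4)%N lt_i lt_r lt_t iE.
  by move=> x y z; lia.
rewrite cE weight4_bot ?[in weight4 _ i]iE ?weight4_bot //; last by lia.
by have := IHk _ lt_r; lia.
Qed.

Lemma weight4_0 (k : nat) : weight4 k 0 = 0%N.
Proof. by rewrite /weight4 big1 // => j _; rewrite div0n mod0n. Qed.

Lemma weight4_even_multiple (h a : nat) : (0 < h)%N -> (a <= 4 ^ h)%N ->
  ~~ odd (weight4 (h + h.+1) (a * (4 ^ h + 1))).
Proof.
move=> h0; rewrite leq_eqVlt => /orP [/eqP -> | lt_a].
  (* The last multiple has exactly two digits 1, at positions h and 2h; the latter is the top
     position. *)
  have -> : (4 ^ h * (4 ^ h + 1) = 4 ^ h * (1 * 4 ^ h + 1) + 0)%N.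
    by rewrite mul1n addn0.
  rewrite weight4_cat ?expn_gt0 // weight4_0 weight4_top // ?(ltn_exp2l 0) //.
  case: h h0 => // k _.
  by rewrite -[X in weight4 _ X]/(4 * 0 + 1)%N weight4_bot // weight4_0.
have -> : (a * (4 ^ h + 1) = 4 ^ h * a + a)%N by rewrite mulnDr muln1 mulnC.
rewrite weight4_cat // -[X in weight4 h.+1 X]add0n -(mul0n (4 ^ h)%N).
by rewrite weight4_top // addn0 addnn odd_double.
Qed.

(** A common divisor divides 3, whereas 4^h + 1 is 2 modulo 3. *)
Lemma coprime_multiplier (h : nat) : coprime (4 ^ (h + h.+1) - 1) (4 ^ h + 1).
Proof.
have -> : (4 ^ (h + h.+1) - 1 = 4 * (4 ^ h - 1) * (4 ^ h + 1) + 3)%N.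
  rewrite addnS expnS expnD; have : (0 < 4 ^ h)%N by rewrite expn_gt0.
  by case: (4 ^ h)%N => // x _; rewrite subSS subn0; nia.
rewrite coprime_sym /coprime gcdnMDl -/(coprime _ 3) coprime_sym prime_coprime //.
by rewrite /dvdn -modnDml -modnXm exp1n.
Qed.

(** Negation modulo n flips the parity of the weight of a nonzero index, because 3m is odd; so
    exactly half of the n - 1 nonzero indices qualify. *)
Lemma card_defining_set (m e : nat) : odd m -> (e < 2)%N ->
  #|defining_set m e| = (2 ^ (2 * m - 1) - 1)%N.
Proof.
move=> m_odd e2; set n := (4 ^ m - 1)%N.
have m0 : (0 < m)%N by case: (m) m_odd.
have E4 : (4 ^ m = 2 * 2 ^ (2 * m - 1))%N.
  by rewrite -expnS subn1 prednK ?muln_gt0 // expnM.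
have n0 : (0 < n)%N.
  by rewrite /n E4; have := expn_gt0 2 (2 * m - 1); move: (2 ^ _)%N; lia.
pose neg (i : 'I_n) := Ordinal (ltn_pmod (n - i) n0).
have negE (i : 'I_n) : neg i = (if i == 0 :> nat then 0 else n - i)%N :> nat.
  rewrite /=; case: eqP => [->|i0]; first by rewrite subn0 modnn.
  by rewrite modn_small //; lia.
have neg_inj : injective neg.
  move=> i j /(congr1 val).
  rewrite -[val (neg i)]/(nat_of_ord _) -[val (neg j)]/(nat_of_ord _) !negE => ij.
  apply: ord_inj; have := ltn_ord i; have := ltn_ord j.
  by move: ij; case: eqP; case: eqP; lia.
have negT : neg @^-1: defining_set m e =
    [set i : 'I_n | (0 < i)%N] :\: defining_set m e.
  apply/setP => i; rewrite !inE -!/n negE.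
  case: eqP => [-> //|i0]; have i_gt0 : (0 < i)%N by lia.
  have lt_i := ltn_ord i; rewrite i_gt0 subn_gt0 lt_i /= andbT.
  have := @weight4_compl m i; rewrite -/n => /(_ (leq_trans lt_i (leq_subr _ _))).
  rewrite !modn2 => /(congr1 odd); rewrite oddD oddM m_odd /=.
  by case: (odd (weight4 m (n - i))); case: (odd (weight4 m i)); case: (odd e).
have : #|[set i : 'I_n | (0 < i)%N]| = n.-1.
  rewrite -[n in RHS]card_ord -cardsT [in RHS](cardsD1 (Ordinal n0)) inE add1n /=.
  by congr #|pred_of_set _|; apply/setP => i; rewrite !inE andbT lt0n.
rewrite -(cardsID (defining_set m e)) -negT card_preimset //.
rewrite (setIidPr _); last by apply/subsetP => i; rewrite !inE => /andP [].
have nE : n = (2 * 2 ^ (2 * m - 1) - 1)%N by rewrite /n E4.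
by move: #|_| (n0) => c n_gt0 cE; rewrite nE in n_gt0 cE; lia.
Qed.

(** * Roots of the generator polynomial *)

Lemma eq_unit_generator_exp (K : finFieldType) (alpha : {unit K}) (i j : nat) :
  generator [set: {unit K}] alpha ->
  (val alpha ^+ i == val alpha ^+ j) = (i == j %[mod #|K|.-1]).
Proof.
move=> /eqP gen_alpha; rewrite -card_finField_unit gen_alpha -orderE.
by rewrite -eq_expg_mod_order -!FinRing.val_unitX.
Qed.

Lemma size_gen_poly_ext (K : finFieldType) (alpha : {unit K}) (m e : nat) :
  size (gen_poly_ext alpha m e) = #|defining_set m e|.+1.
Proof. by rewrite /gen_poly_ext -big_enum size_prod_XsubC -cardE. Qed.

(** The roots alpha^j are pairwise distinct n-th roots of unity. *)
Lemma gen_poly_ext_dvdp (K : finFieldType) (alpha : {unit K}) (m e : nat) :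
  #|K| = (4 ^ m)%N -> generator [set: {unit K}] alpha ->
  gen_poly_ext alpha m e %| 'X^(4 ^ m - 1) - 1.
Proof.
move=> cardK alpha_gen; have alphaE i j := eq_unit_generator_exp i j alpha_gen.
rewrite cardK -subn1 in alphaE; set n := (4 ^ m - 1)%N in alphaE *.
rewrite /gen_poly_ext -big_enum.
rewrite -(big_map (fun j : 'I_n => val alpha ^+ j) predT (fun x => 'X - x%:P)).
apply: uniq_roots_dvdp; rewrite ?uniq_rootsE.
  apply/allP => _ /mapP [j _ ->]; rewrite rootE !hornerE -exprM subr_eq0.
  by rewrite -(expr0 (val alpha)) alphaE mod0n modnMl.
rewrite map_inj_uniq ?enum_uniq // => i j /eqP.
by rewrite alphaE !modn_small // => /eqP /ord_inj.
Qed.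

Section Code.

Variables (F K : finFieldType) (iota : {rmorphism F -> K}).
Variables (alpha : {unit K}) (m e : nat).
Hypotheses (cardF : #|F| = 4) (cardK : #|K| = (4 ^ m)%N).
Hypotheses (alpha_gen : generator [set: {unit K}] alpha) (m_gt0 : (0 < m)%N).

Let n_gt0 : (0 < 4 ^ m - 1)%N.
Proof. by rewrite subn_gt0 (ltn_exp2l 0). Qed.

Lemma gen_poly_dvdp : gen_poly iota alpha m e %| 'X^(4 ^ m - 1) - 1.
Proof.
rewrite -(dvdp_map iota) map_gen_poly // rmorphB rmorph1 /= map_polyXn.
exact: gen_poly_ext_dvdp.
Qed.

Lemma dim_code :
  \dim (code iota alpha m e) = (4 ^ m - 1 - #|defining_set m e|)%N.
Proof.
rewrite dim_cyclic_code ?gen_poly_dvdp // -(size_map_poly iota) map_gen_poly //.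
by rewrite size_gen_poly_ext.
Qed.

Lemma code_root v j : v \in code iota alpha m e -> j \in defining_set m e ->
  root (map_poly iota (rVpoly v)) (val alpha ^+ j).
Proof.
rewrite mem_cyclic_code_dvdp ?gen_poly_dvdp // -(dvdp_map iota) map_gen_poly //.
move=> gdvd Tj; rewrite -dvdp_XsubCl; apply: dvdp_trans gdvd.
by rewrite /gen_poly_ext (bigD1 j) //= dvdp_mulIl.
Qed.

End Code.

(** * Dimension and distance of the two codes *)

Theorem theorem5p1p3 (m : nat) (F K : finFieldType) (iota : {rmorphism F -> K})
    (alpha : {unit K}) (e : 'I_2)
    (cardF : #|F| = 4%N) (cardK : #|K| = (4 ^ m)%N)
    (alpha_gen : generator [set: {unit K}] alpha)
    (m_ge5 : (5 <= m)%N) (m_odd : odd m) :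
  exists d : nat,
    [/\ has_parameters (code iota alpha m e) (2 ^ (2 * m - 1)) d,
        m = 1 %[mod 4] -> (4 ^ ((m - 1) %/ 2) + 1 <= d)%N
      & m = 3 %[mod 4] -> (4 ^ ((m - 3) %/ 2) + 1 <= d)%N].
Proof.
have m0 : (0 < m)%N by apply: leq_trans m_ge5.
pose h := m./2.
have h0 : (0 < h)%N by rewrite half_gt0; apply: leq_trans m_ge5.
have mE : m = (h + h.+1)%N.
  by rewrite -[LHS]odd_double_half m_odd -addnn addnS add1n.
have dimC : \dim (code iota alpha m e) = (2 ^ (2 * m - 1))%N.
  rewrite dim_code // card_defining_set //.
  have -> : (4 ^ m = 2 * 2 ^ (2 * m - 1))%N.
    by rewrite -expnS subn1 prednK ?muln_gt0 // expnM.
  by have := expn_gt0 2 (2 * m - 1); move: (2 ^ _)%N => N /= N0; lia.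
have C0 : code iota alpha m e != 0%VS.
  by rewrite -dimv_eq0 dimC -lt0n expn_gt0.
have h4 : (0 < 4 ^ h)%N by rewrite expn_gt0.
pose n := (4 ^ m - 1)%N; pose w := (4 ^ h + 1)%N.
(* The exponents aw stay below n, so their weights can be read off without reduction modulo n. *)
have aw_lt a : (a <= 4 ^ h)%N -> (a * w < n)%N.
  move=> le_a; have : (a * w <= 4 ^ h * w)%N by rewrite leq_mul2r le_a orbT.
  rewrite /n /w mE [(h + _)%N]addnS expnS expnD.
  have : (4 ^ h <= 4 ^ h * 4 ^ h)%N by rewrite leq_pmulr.
  have : (4 <= 4 ^ h)%N by rewrite (leq_exp2l 1).
  by move: (4 ^ h)%N => x; lia.
have even_w a : (a <= 4 ^ h)%N -> ~~ odd (weight4 m (a * w)).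
  by rewrite mE; apply: weight4_even_multiple.
have w0 : (0 < w)%N by rewrite /w addn1.
have co_w : coprime n w by rewrite /n /w mE coprime_multiplier.
have alphaE i j := eq_unit_generator_exp i j alpha_gen.
rewrite cardK -subn1 -/n in alphaE.
have alpha0 : val alpha != 0 by rewrite -unitfE (valP alpha).
have pow_inj : injective (fun j : 'I_n => (val alpha ^+ w) ^+ j).
  move=> i j /eqP; rewrite -!exprM alphaE => ij; apply: ord_inj.
  wlog le_ij : i j ij / (i <= j)%N => [wl|].
    by case/orP: (leq_total i j) => le; [|symmetry]; apply: wl => //; rewrite eq_sym.
  move: ij; rewrite eq_sym eqn_mod_dvd ?leq_mul2l ?le_ij ?orbT // -mulnBr.
  by rewrite Gauss_dvdr // -eqn_mod_dvd // !modn_small // => /eqP.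
have C_dist v : v \in code iota alpha m e -> v != 0 ->
    (4 ^ h + 1 <= hamming_dist v 0)%N.
  move=> Cv v0; rewrite addn1; case: (posnP e) => [e0|e_gt0].
    apply: (bch_bound (iota := iota) (b := val alpha ^+ w)) => //.
      by rewrite expf_neq0.
    move=> a /andP [a0 le_a]; rewrite -exprM mulnC.
    apply: (code_root cardF cardK alpha_gen m0 Cv (j := Ordinal (aw_lt a le_a))).
    by rewrite inE /= muln_gt0 a0 w0 e0 modn2 (negPf (even_w _ le_a)).
  have e1 : e = 1%N :> nat by apply/eqP; rewrite eqn_leq e_gt0 -ltnS ltn_ord.
  apply: (bch_bound (iota := iota) (b := (val alpha ^+ w)^-1)) => //.
  - by rewrite invr_eq0 expf_neq0.
  - by move=> i j; rewrite !exprVn => /invr_inj /pow_inj.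
  move=> a /andP [a0 le_a]; have lt_aw := aw_lt a le_a.
  have aw0 : (0 < a * w)%N by rewrite muln_gt0 a0 w0.
  have lt_n : (n - a * w < n)%N by rewrite -subn_gt0 subKn // ltnW.
  (* Rewriting alpha^(-aw) with exponent n - aw makes its weight 3m minus an even number, hence
     odd. *)
  have -> : (val alpha ^+ w)^-1 ^+ a = val alpha ^+ (n - a * w).
    rewrite exprVn -exprM mulnC; apply: (mulfI (expf_neq0 (a * w) alpha0)).
    rewrite mulfV ?expf_neq0 // -exprD subnKC ?(ltnW lt_aw) //.
    by apply/esym/eqP; rewrite -(expr0 (val alpha)) alphaE modnn mod0n.
  apply: (code_root cardF cardK alpha_gen m0 Cv (j := Ordinal lt_n)).
  rewrite inE /= subn_gt0 lt_aw e1 !modn2 /=.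
  have := weight4_compl (leq_trans lt_aw (leq_subr _ _)).
  move=> /(congr1 odd); rewrite oddD oddM m_odd /= (negPf (even_w _ le_a)) addbF.
  by move=> ->.
have [d dC le_d] := exists_min_distance C0 C_dist.
(* Both (m-1)/2 and (m-3)/2 are at most h. *)
exists d; split=> // _; apply: leq_trans le_d; rewrite leq_add2r leq_exp2l //.
  by rewrite /h -divn2 leq_div2r // leq_subr.
by rewrite /h -divn2 leq_div2r // leq_subr.
Qed.
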